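(* Let $N=(V,A,c)$ be a network and let $x,y,z\in V$ with $y\neq z$. Then $\lambda^N_{yz}(x)=\varphi^N_{yz}(x)$.
   Context: $\mathbb{N}_0$ is the set of non-negative integers; $[m]=\{1,\dots,m\}$ and $[0]=\varnothing$. A network $N=(V,A,c)$ consists of a finite set $V$ with $|V|\ge 2$, the arc set $A=\{(u,v)\in V^2: u\ne v\}$ of the complete digraph on $V$, and a capacity function $c:A\to\mathbb{N}_0$. For $u\in V$, $A_u^+$ is the set of arcs $(u,v)\in A$ and $A_u^-$ is the set of arcs $(v,u)\in A$. Flows. For distinct $y,z\in V$, a flow from $y$ to $z$ in $N$ is a function $f:A\to\mathbb{N}_0$ with $f(a)\le c(a)$ for all $a\in A$ and $\sum_{a\in A_u^-}f(a)=\sum_{a\in A_u^+}f(a)$ for all $u\in V\setminus\{y,z\}$. Its value is $v(f)=\sum_{a\in A_y^+}f(a)-\sum_{a\in A_y^-}f(a)$. $\varphi^N_{yz}$ denotes the maximum of $v(f)$ over all flows $f$ from $y$ to $z$ in $N$. For $X\subseteq V$, $N_X=(V,A,c_X)$ is the network with $c_X(a)=0$ if at least one endpoint of $a$ lies in $X$, and $c_X(a)=c(a)$ otherwise. Define $\varphi^N_{yz}(X)=\varphi^N_{yz}-\varphi^{N_X}_{yz}$. Paths. A path from $y$ to $z$ in $N$ is given by distinct vertices $x_1=y,x_2,\dots,x_k=z$ ($k\ge2$) with arcs $(x_i,x_{i+1})$, $i\in[k-1]$, all of capacity at least $1$; for such a path $\gamma$, $V(\gamma)$ and $A(\gamma)$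 denote its sets of vertices and arcs. It passes through $X\subseteq V$ if $X\cap V(\gamma)\neq\varnothing$. For $m\in\mathbb{N}_0$, a sequence $\boldsymbol{\gamma}=(\gamma_j)_{j\in[m]}$ of $m$ paths (repetitions allowed) from $y$ to $z$ in $N$ is arc-disjoint if $|\{j\in[m]:a\in A(\gamma_j)\}|\le c(a)$ for every $a\in A$; its length is $m$ (the empty sequence, of length $0$, is arc-disjoint). $\mathcal{M}^N_{yz}$ is the set of arc-disjoint sequences of paths from $y$ to $z$ in $N$ of maximum length. $l_X(\boldsymbol{\gamma})$ is the number of indices $j\in[m]$ such that $\gamma_j$ passes through $X$. Define $\lambda^N_{yz}(X)=\min_{\boldsymbol{\gamma}\in\mathcal{M}^N_{yz}}l_X(\boldsymbol{\gamma})$. For a vertex $x$, write $\varphi^N_{yz}(x)=\varphi^N_{yz}(\{x\})$ and $\lambda^N_{yz}(x)=\lambda^N_{yz}(\{x\})$. *)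

(* Defs.v *)
From mathcomp Require Import all_boot all_order all_algebra.
From mathcomp Require Import boolp.

Set Implicit Arguments.
Unset Strict Implicit.
Unset Printing Implicit Defensive.

Import Order.TTheory GRing.Theory Num.Theory.

Definition arc (V : finType) : finType := {a : V * V | a.1 != a.2}.

Definition src (V : finType) (a : arc V) : V := (val a).1.
Definition tgt (V : finType) (a : arc V) : V := (val a).2.

Record network (V : finType) := Network {
  cap : arc V -> nat;
  card_gt1 : 1 < #|V|
}.

Definition delete (V : finType) (N : network V) (X : {set V}) : network V :=
  Network (fun a => if (src a \in X) || (tgt a \in X) then 0 else cap N a)
          (card_gt1 N).

Definition outflow (V : finType) (f : arc V -> nat) (u : V) : nat :=
  \sum_(a : arc V | src a == u) f a.
Definition inflow (V : finType) (f : arc V -> nat) (u : V) : nat :=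
  \sum_(a : arc V | tgt a == u) f a.

Definition is_flow (V : finType) (N : network V) (y z : V) (f : arc V -> nat) :
    Prop :=
  (forall a, f a <= cap N a) /\
  (forall u, u != y -> u != z -> inflow f u = outflow f u).

Definition flow_value (V : finType) (y : V) (f : arc V -> nat) : int :=
  (Posz (outflow f y) - Posz (inflow f y))%R.

Definition is_max_flow (V : finType) (N : network V) (y z : V)
    (f : arc V -> nat) : Prop :=
  is_flow N y z f /\
  (forall g, is_flow N y z g -> (flow_value y g <= flow_value y f)%R).

Lemma max_flow_exists (V : finType) (N : network V) (y z : V) :
  exists f, is_max_flow N y z f.
Proof.
pose P n := `[< exists f, is_flow N y z f /\ flow_value y f = Posz n >].
have exP : exists n, P n.
  exists 0; apply/asboolP; exists (fun=> 0); split; first split => // u _ _.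
    by rewrite /inflow /outflow !big1.
  by rewrite /flow_value /inflow /outflow !big1.
have ubP n : P n -> n <= \sum_(a : arc V) cap N a.
  move=> /asboolP[f [[fc _] vf]].
  apply: (@leq_trans (outflow f y)).
    by rewrite -lez_nat -vf /flow_value gerBl.
  rewrite /outflow big_mkcond /=; apply: leq_sum => a _.
  by case: ifP => // _; apply: fc.
case: (ex_maxnP exP ubP) => m /asboolP[f [ff vf]] max_m.
exists f; split => // g fg; rewrite vf.
case E: (flow_value y g) => [n|n] //.
by rewrite lez_nat; apply: max_m; apply/asboolP; exists g.
Qed.

Definition max_flow_value (V : finType) (N : network V) (y z : V) : int :=
  flow_value y (sval (cid (max_flow_exists N y z))).

Definition phi (V : finType) (N : network V) (y z : V) (X : {set V}) : int :=
  (max_flow_value N y z - max_flow_value (delete N X) y z)%R.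

(* A path is encoded by the list [:: x_1; ...; x_k] of its vertices. *)
Definition path_vertices (V : finType) (p : seq V) : {set V} := [set v in p].
Definition path_arcs (V : finType) (p : seq V) : {set arc V} :=
  [set a : arc V | val a \in zip p (behead p)].

(* The default values given to [head] and [last] are never used, since
   [p] is required to have at least two elements. All the pairs of consecutive
   vertices of [p] are arcs, since [p] is duplicate-free. *)
Definition is_path (V : finType) (N : network V) (y z : V) (p : seq V) : bool :=
  [&& 2 <= size p, uniq p, head y p == y, last y p == z
    & [forall a in path_arcs p, 1 <= cap N a]].

Definition passes (V : finType) (X : {set V}) (p : seq V) : bool :=
  X :&: path_vertices p != set0.

Definition arc_disjoint (V : finType) (N : network V) (y z : V)
    (g : seq (seq V)) : Prop :=
  all (is_path N y z) g /\
  (forall a : arc V, count (fun p => a \in path_arcs p) g <= cap N a).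

Definition max_arc_disjoint (V : finType) (N : network V) (y z : V)
    (g : seq (seq V)) : Prop :=
  arc_disjoint N y z g /\
  (forall h, arc_disjoint N y z h -> size h <= size g).

Definition num_passing (V : finType) (X : {set V}) (g : seq (seq V)) : nat :=
  count (passes X) g.

Lemma path_arcs_neq0 (V : finType) (N : network V) (y z : V) (p : seq V) :
  is_path N y z p -> exists a, a \in path_arcs p.
Proof.
case: p => [|u [|v p]] //= /and3P[_ /= /andP[uv _] _].
have uv' : (u, v).1 != (u, v).2.
  by apply: contraNneq uv => /= ->; rewrite mem_head.
by exists (Sub (u, v) uv'); rewrite inE SubK /= mem_head.
Qed.

Lemma arc_disjoint_size (V : finType) (N : network V) (y z : V)
    (g : seq (seq V)) :
  arc_disjoint N y z g -> size g <= \sum_(a : arc V) cap N a.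
Proof.
move=> [pg cg].
apply: (@leq_trans (\sum_(a : arc V) count (fun p => a \in path_arcs p) g)).
  elim: g pg {cg} => [|p g IH] //= /andP[pp pg].
  rewrite big_split /= -add1n leq_add ?IH //.
  by have [a ap] := path_arcs_neq0 pp; rewrite (bigD1 a) //= ap.
by apply: leq_sum => a _; apply: cg.
Qed.

Lemma min_passing_exists (V : finType) (N : network V) (y z : V)
    (X : {set V}) :
  exists g, max_arc_disjoint N y z g /\
    (forall h, max_arc_disjoint N y z h -> num_passing X g <= num_passing X h).
Proof.
pose P n := `[< exists g, arc_disjoint N y z g /\ size g = n >].
have exP : exists n, P n by exists 0; apply/asboolP; exists [::].
have ubP n : P n -> n <= \sum_(a : arc V) cap N a.
  by move=> /asboolP[g [gd <-]]; apply: arc_disjoint_size gd.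
case: (ex_maxnP exP ubP) => m /asboolP[g [gd gm]] max_m.
pose Q n := `[< exists g, max_arc_disjoint N y z g /\ num_passing X g = n >].
have exQ : exists n, Q n.
  exists (num_passing X g); apply/asboolP; exists g; split => //; split => // h hd.
  by rewrite gm; apply: max_m; apply/asboolP; exists h.
case: (ex_minnP exQ) => k /asboolP[g' [g'd g'k]] min_k.
exists g'; split => // h hd.
by rewrite g'k; apply: min_k; apply/asboolP; exists h.
Qed.

Definition lambda (V : finType) (N : network V) (y z : V) (X : {set V}) : nat :=
  num_passing X (sval (cid (min_passing_exists N y z X))).

(* Main.v *)
From mathcomp Require Import all_boot all_order all_algebra.
From mathcomp Require Import boolp.
From mathcomp Require Import zify.
Require Import Defs.

(** Arc-disjoint sequences of paths and flows carry the same information: the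
    number of paths of a sequence using each arc is a flow, whose value is the
    length of the sequence ([is_flow_path_flow]), and conversely a flow of value
    n dominates the arc usage of some sequence of n paths
    ([flow_decomposition]). In particular the maximum length of an arc-disjoint
    sequence is the maximum value of a flow ([max_arc_disjoint_size]).

    The inequality phi <= lambda holds for any set X: in a maximum sequence, the
    paths that avoid X form an arc-disjoint sequence of the network without X,
    so there are at most as many of them as the maximum flow value there
    ([phi_le_lambda]).

    The converse needs a maximum flow of N that sends at most phi units through
    x. Start from a maximum flow of the network without x, seen as a flow of N
    with no inflow at x, and augment it along simple paths of the residual
    graph until it is maximum in N. Since each augmentation adds 1 to the value,
    exactly phi of them are performed. A simple path visits x at most once,
    hence each augmentation raises the inflow at x by at most 1 ([augment]), and
    the final inflow is at most phi ([max_flow_small_inflow]). Every path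
    through x of a decomposition of this flow uses one unit of that inflow, so
    at most phi paths of the decomposition pass through x ([lambda_le_phi]).
    This counting fails when x is the source y, since paths do not enter it, but
    then the network without x has no flow of positive value and phi is the
    length of any maximum sequence. *)

Set Implicit Arguments.
Unset Strict Implicit.
Unset Printing Implicit Defensive.

Import Order.TTheory GRing.Theory Num.Theory.

(** * Net outflow of vertices and of cuts *)

Section FlowValue.
Variable V : finType.
Implicit Types (f g h : arc V -> nat) (a b : arc V) (u v y z : V) (S : {set V}).

Lemma outflowD f g h u :
  (forall a, h a = f a + g a) -> outflow h u = outflow f u + outflow g u.
Proof. by move=> hE; rewrite /outflow -big_split; apply: eq_bigr. Qed.

Lemma inflowD f g h u :
  (forall a, h a = f a + g a) -> inflow h u = inflow f u + inflow g u.
Proof. by move=> hE; rewrite /inflow -big_split; apply: eq_bigr. Qed.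

Lemma flow_valueD f g h u : (forall a, h a = f a + g a) ->
  flow_value u h = (flow_value u f + flow_value u g)%R.
Proof. by move=> hE; rewrite /flow_value (outflowD u hE) (inflowD u hE); lia. Qed.

Lemma outflow0 u : outflow (fun _ : arc V => 0) u = 0.
Proof. exact: big1. Qed.

Lemma inflow0 u : inflow (fun _ : arc V => 0) u = 0.
Proof. exact: big1. Qed.

Lemma sum_delta (P : pred (arc V)) a : \sum_(b | P b) (b == a : nat) = P a.
Proof.
rewrite big_mkcond (bigD1 a) //= eqxx big1 ?addn0; first by case: (P a).
by move=> b /negbTE->; rewrite if_same.
Qed.

Lemma flow_value_delta a u :
  flow_value u (fun b => (b == a : nat)) =
  (Posz (src a == u) - Posz (tgt a == u))%R.
Proof. by rewrite /flow_value /outflow /inflow !sum_delta. Qed.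

Definition cut f S : nat := \sum_(a | (src a \in S) && (tgt a \notin S)) f a.

(** Each arc with both ends in [S] contributes once as an outgoing arc and once
    as an incoming arc, so only the arcs that cross the cut remain. *)
Lemma sum_flow_value f S :
  (\sum_(u in S) flow_value u f = Posz (cut f S) - Posz (cut f (~: S)))%R.
Proof.
pose inner := \sum_(a | (src a \in S) && (tgt a \in S)) f a.
have outE : \sum_(u in S) outflow f u = cut f S + inner.
  rewrite [RHS]addnC -(bigID (fun a => tgt a \in S)) /=.
  rewrite (partition_big (@src V) (mem S)) //=.
  apply: eq_bigr => u uS; apply: eq_bigl => a.
  by case: eqP => [->|]; rewrite ?uS ?andbF.
have inE : \sum_(u in S) inflow f u = cut f (~: S) + inner.
  have -> : cut f (~: S) = \sum_(a | (tgt a \in S) && (src a \notin S)) f a.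
    by apply: eq_bigl => a; rewrite !in_setC negbK andbC.
  have -> : inner = \sum_(a | (tgt a \in S) && (src a \in S)) f a.
    by apply: eq_bigl => a; rewrite andbC.
  rewrite [RHS]addnC -(bigID (fun a => src a \in S)) /=.
  rewrite (partition_big (@tgt V) (mem S)) //=.
  apply: eq_bigr => u uS; apply: eq_bigl => a.
  by case: eqP => [->|]; rewrite ?uS ?andbF.
rewrite /flow_value sumrB -!(big_morph Posz PoszD (erefl _)) outE inE; lia.
Qed.

(** [flow_value] makes sense at every vertex, as the net outflow there;
    conservation then says that it vanishes at the inner vertices. *)
Lemma is_flowP (N : network V) y z f : is_flow N y z f <->
  (forall a, f a <= cap N a) /\
  (forall u, u != y -> u != z -> flow_value u f = 0%R).
Proof.
split=> -[fc fb]; split=> // u uy uz; have := fb u uy uz;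
  rewrite /flow_value; lia.
Qed.

Lemma flow_value_cut (N : network V) y z f S :
  is_flow N y z f -> y \in S -> z \notin S ->
  flow_value y f = (Posz (cut f S) - Posz (cut f (~: S)))%R.
Proof.
move=> /is_flowP[_ fb] yS zS; rewrite -sum_flow_value (bigD1 y) //= big1 ?addr0 //.
by move=> u /andP[uS uy]; apply: fb => //; apply: contraNneq zS => <-.
Qed.

End FlowValue.

(** * Augmentation along residual paths *)

Section Augmentation.
Variable V : finType.
Implicit Types (N : network V) (f g h : arc V -> nat) (a b : arc V) (u v y z : V).

(** One unit can be pushed from [u] to [v] either by using spare capacity
    from [u] to [v] or by cancelling a unit that flows from [v] to [u]. *)
Definition residual N f : rel V := fun u v =>
  [exists a, [&& src a == u, tgt a == v & f a < cap N a]] ||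
  [exists a, [&& src a == v, tgt a == u & 0 < f a]].

(** If the residual graph of [f] does not lead from [y] to [z], let [S] be the
    set of vertices reached from [y]. All arcs leaving [S] are saturated by [f]
    and all arcs entering [S] are empty, so the value of [f] is the capacity of
    the cut [S], which bounds the value of [g]. *)
Lemma augmenting_path N y z f g :
  is_flow N y z f -> is_flow N y z g ->
  (flow_value y f < flow_value y g)%R ->
  exists p, [/\ path (residual N f) y p, uniq (y :: p) & last y p = z].
Proof.
move=> ff fg lt_fg.
have: connect (residual N f) y z.
  apply: contraLR lt_fg => Nyz; rewrite -leNgt.
  pose S := [set u | connect (residual N f) y u].
  have yS : y \in S by rewrite inE connect0.
  have zS : z \notin S by rewrite inE.
  have closedS u v : u \in S -> v \notin S -> ~~ residual N f u v.
    rewrite !inE => yu; apply: contra => uv.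
    exact: connect_trans yu (connect1 uv).
  have cutf : cut f (~: S) = 0.
    apply: big1 => a; rewrite !in_setC negbK => /andP[sa ta].
    have /norP[_ /existsPn/(_ a)] := closedS _ _ ta sa.
    by rewrite !eqxx /= -eqn0Ngt => /eqP.
  have cutgf : cut g S <= cut f S.
    apply: leq_sum => a /andP[sa ta].
    have /norP[/existsPn/(_ a) + _] := closedS _ _ sa ta.
    by rewrite !eqxx /= -leqNgt; apply: leq_trans; case: fg.
  rewrite (flow_value_cut ff yS zS) (flow_value_cut fg yS zS) cutf; lia.
by case/connectP=> p ep ->; case/shortenP: ep => q eq uq _; exists q.
Qed.

(** The last clause keeps the rest of a simple residual path usable after its
    first step has been performed. *)
Lemma push_arc N f u v :
  (forall a, f a <= cap N a) -> residual N f u v ->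
  exists f', [/\ forall a, f' a <= cap N a,
    forall w, flow_value w f' =
      (flow_value w f + Posz (u == w) - Posz (v == w))%R,
    forall w, inflow f' w <= inflow f w + (v == w) &
    forall a, src a != u -> tgt a != u -> f' a = f a].
Proof.
move=> fc /orP[] /existsP[a /and3P[/eqP sa /eqP ta fa]].
- exists (fun b => f b + (b == a)); split.
  + by move=> b; case: eqP => [->|_]; rewrite ?addn1 ?addn0.
  + move=> w; rewrite (flow_valueD w (fun=> erefl)) flow_value_delta sa ta; lia.
  + by move=> w; rewrite (inflowD w (fun=> erefl)) [X in _ + X]sum_delta ta.
  + by move=> b sb _; case: (b =P a) sb => [->|_]; rewrite ?sa ?eqxx ?addn0.
- have fE b : f b = (f b - (b == a)) + (b == a).
    by rewrite subnK //; case: eqP => [->|].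
  exists (fun b => f b - (b == a)); split.
  + by move=> b; apply: leq_trans (leq_subr _ _) _.
  + move=> w; rewrite (flow_valueD w fE) flow_value_delta sa ta; lia.
  + by move=> w; rewrite (inflowD w fE) -addnA leq_addr.
  + by move=> b _ tb; case: (b =P a) tb => [->|_]; rewrite ?ta ?eqxx ?subn0.
Qed.

(** On a simple path, the inflow at [w] can only grow in the single step that
    reaches [w]: the step that leaves [w] either adds to the outflow of [w] or
    decreases its inflow. *)
Lemma push_path N f u p :
  (forall a, f a <= cap N a) -> path (residual N f) u p -> uniq (u :: p) ->
  exists f', [/\ forall a, f' a <= cap N a,
    forall w, flow_value w f' =
      (flow_value w f + Posz (u == w) - Posz (last u p == w))%R &
    forall w, inflow f' w <= inflow f w + (w \in p)].
Proof.
elim: p u f => [|v p IH] u f fc.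
  by move=> _ _; exists f; split=> // w; rewrite ?addn0 //=; lia.
rewrite cons_uniq => /= /andP[uv pp] /andP[u_vp uvp].
have [f1 [f1c f1v f1i f1E]] := push_arc fc uv.
(* [u] does not occur again, so the residual graphs of [f] and [f1] agree on
   the vertices of the remaining path. *)
have pp1 : path (residual N f1) v p.
  rewrite -(@eq_in_path _ (predC1 u) (residual N f)) //.
    move=> s t su tu; rewrite /residual; congr orb; apply: eq_existsb => a.
      case: eqP => [sa|]; case: eqP => [ta|] //=.
      by rewrite f1E ?sa ?ta.
    case: eqP => [sa|]; case: eqP => [ta|] //=.
    by rewrite f1E ?sa ?ta.
  by apply/allP=> w wp; apply: contraNneq u_vp => <-.
have [f2 [f2c f2v f2i]] := IH _ _ f1c pp1 uvp.
exists f2; split=> // w; first by rewrite f2v f1v /=; lia.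
apply: leq_trans (f2i w) _; apply: leq_trans (leq_add (f1i w) (leqnn _)) _.
rewrite -addnA leq_add2l in_cons eq_sym.
by case: eqP uvp => [->|_ _] /=; first by case/andP=> /negbTE->.
Qed.

Lemma augment N y z f g : y != z ->
  is_flow N y z f -> is_flow N y z g ->
  (flow_value y f < flow_value y g)%R ->
  exists f', [/\ is_flow N y z f', flow_value y f' = (flow_value y f + 1)%R &
    forall x, inflow f' x <= (inflow f x).+1].
Proof.
move=> yz ff fg lt_fg; have [p [pp up lp]] := augmenting_path ff fg lt_fg.
have /is_flowP[fc fb] := ff; have [f' [f'c f'v f'i]] := push_path fc pp up.
exists f'; split.
- apply/is_flowP; split=> // u uy uz.
  by rewrite f'v fb // lp ![_ == u]eq_sym (negbTE uy) (negbTE uz).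
- by rewrite f'v lp eqxx [z == y]eq_sym (negbTE yz); lia.
- move=> x; apply: leq_trans (f'i x) _; rewrite -addn1 leq_add2l; exact: leq_b1.
Qed.

Lemma augment_to_max N y z f g n : y != z ->
  is_flow N y z f -> is_flow N y z g ->
  flow_value y g = (flow_value y f + Posz n)%R ->
  exists f', [/\ is_flow N y z f', flow_value y f' = flow_value y g &
    forall x, inflow f' x <= inflow f x + n].
Proof.
move=> yz; elim: n f => [|n IH] f ff fg gE.
  by exists f; split=> // [|x]; [lia|rewrite addn0].
have lt_fg : (flow_value y f < flow_value y g)%R by lia.
have [f1 [ff1 f1v f1i]] := augment yz ff fg lt_fg.
have g1E : flow_value y g = (flow_value y f1 + Posz n)%R by lia.
have [f' [ff' f'v f'i]] := IH _ ff1 fg g1E.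
by exists f'; split=> // x; have := f'i x; have := f1i x; lia.
Qed.

End Augmentation.

(** * Paths and their arcs *)

Section Paths.
Variable V : finType.
Implicit Types (N : network V) (f : arc V -> nat) (a : arc V) (u v w x y z : V).
Implicit Types (p q : seq V) (g : seq (seq V)) (X : {set V}).

Lemma mem_zip_fst_snd (s t : seq V) (e : V * V) :
  e \in zip s t -> (e.1 \in s) && (e.2 \in t).
Proof.
elim: s t => [|u s IH] [|v t] //=; rewrite !in_cons.
by case/predU1P => [-> | /IH/andP[-> ->]]; rewrite ?eqxx ?orbT.
Qed.

Lemma path_arcs_ends p a : a \in path_arcs p -> (src a \in p) && (tgt a \in p).
Proof.
rewrite inE => /mem_zip_fst_snd /andP[sa ta].
by apply/andP; split=> //; apply: mem_behead.
Qed.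

(** A sum of indicators, rather than a disjunction, is what makes inflow and
    outflow additive along a path. It needs the first arc not to occur again. *)
Lemma mem_path_arcs_cons u v p a : uniq [:: u, v & p] ->
  (a \in path_arcs [:: u, v & p] : nat) =
  ((src a == u) && (tgt a == v)) + (a \in path_arcs (v :: p)).
Proof.
move=> /= /andP[u_vp _].
have vpE : (a \in path_arcs (v :: p)) = (val a \in zip (v :: p) p) by rewrite inE.
rewrite inE /= in_cons -vpE -[val a == _]/((src a == u) && (tgt a == v)).
case: eqP => [sa|//] /=.
case vp: (a \in path_arcs (v :: p)); last by rewrite orbF addn0.
by have := path_arcs_ends vp; rewrite sa (negbTE u_vp).
Qed.

(** A simple path enters each of its vertices but the first exactly once, and
    leaves each of them but the last exactly once. *)
Lemma inoutflow_path_arcs u p w : uniq (u :: p) ->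
  let f := fun a : arc V => (a \in path_arcs (u :: p) : nat) in
  inflow f w = (w \in p) /\ outflow f w = (w \in belast u p).
Proof.
elim: p u => [|v p IH] u uq /=.
  by split; apply: big1 => a _; rewrite inE.
have [Hi Ho] := IH v (subseq_uniq (subseq_cons _ _) uq).
have uv : u != v by move: uq; rewrite /= inE negb_or -andbA => /and3P[].
pose a0 : arc V := Sub (u, v) uv.
have fE a : (a \in path_arcs [:: u, v & p] : nat) =
            (a == a0) + (a \in path_arcs (v :: p)).
  by rewrite mem_path_arcs_cons.
rewrite (inflowD w fE) (outflowD w fE) Hi Ho {1}/inflow {1}/outflow !sum_delta.
rewrite /src /tgt /= !in_cons ![w == _]eq_sym; move: uq => /= /andP[u_vp /andP[vp _]].
split; first by case: eqP => [<-|//]; rewrite (negbTE vp).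
case: eqP => [<-|//].
suff /negbTE-> : u \notin belast v p by [].
by apply: contra u_vp; apply: mem_belast.
Qed.

Lemma inflow_path_arcs u p w : uniq (u :: p) ->
  inflow (fun a => (a \in path_arcs (u :: p) : nat)) w = (w \in p).
Proof. by case/(inoutflow_path_arcs w). Qed.

Lemma flow_value_path_arcs u p w : uniq (u :: p) ->
  flow_value w (fun a => (a \in path_arcs (u :: p) : nat)) =
  (Posz (u == w) - Posz (last u p == w))%R.
Proof.
move=> uq; rewrite /flow_value; have [-> ->] := inoutflow_path_arcs w uq.
have : count_mem w (u :: p) = count_mem w (rcons (belast u p) (last u p)).
  by rewrite -lastI.
have ub : uniq (belast u p) by move: uq; rewrite lastI rcons_uniq => /andP[].
rewrite -cats1 count_cat /= addn0 !count_uniq_mem //; last by case/andP: uq.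
move: (_ == w : nat) (w \in p : nat) (w \in belast u p : nat) (last u p == w : nat) => *; lia.
Qed.

Lemma path_arcs_edge (e : rel V) u p a :
  path e u p -> a \in path_arcs (u :: p) -> e (src a) (tgt a).
Proof.
elim: p u => [|v p IH] u; first by rewrite inE.
move=> /= /andP[uv vp]; rewrite inE /= in_cons => /predU1P[aE|ap].
  by rewrite (congr1 fst aE : src a = u) (congr1 snd aE : tgt a = v).
by apply: IH vp _; rewrite inE.
Qed.

(** As [y != z], the condition on the size of [p] follows from the one on its
    endpoints. *)
Lemma is_pathP N y z p : y != z -> reflect
  (exists q, [/\ p = y :: q, uniq (y :: q), last y q = z &
     forall a, a \in path_arcs p -> 0 < cap N a])
  (is_path N y z p).
Proof.
move=> yz; apply: (iffP and5P) => [[sp up hp lp /forall_inP cp]|].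
  case: p sp up hp lp cp => [|u q] //= _ uq /eqP uy /eqP lq cq.
  by rewrite uy in uq lq cq *; exists q.
case=> -[|v q] [-> uq lq cq]; first by rewrite -lq eqxx in yz.
by split=> //; [apply/eqP|apply/forall_inP].
Qed.

Lemma passes_set1 x p : passes [set x] p = (x \in p).
Proof.
apply/set0Pn/idP => [[v]|xp]; first by rewrite !inE => /andP[/eqP->].
by exists x; rewrite !inE eqxx.
Qed.

(** * Flows and arc-disjoint sequences of paths *)

Definition path_flow g a := count (fun p => a \in path_arcs p) g.

Lemma flow_value_path_flow N y z g w : y != z -> all (is_path N y z) g ->
  flow_value w (path_flow g) =
    ((Posz (y == w) - Posz (z == w)) * Posz (size g))%R.
Proof.
move=> yz; elim: g => [|p g IH].
  by move=> _; rewrite /flow_value outflow0 inflow0 /=; lia.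
case/andP=> /(is_pathP _ _ yz)[q [-> uq lq _]] /IH IHg.
rewrite (flow_valueD w (fun=> erefl)) IHg flow_value_path_arcs // lq /=.
by rewrite intS; lia.
Qed.

Lemma inflow_path_flow N y z g w : y != z -> all (is_path N y z) g ->
  w != y -> inflow (path_flow g) w = num_passing [set w] g.
Proof.
move=> yz gp wy; elim: g gp => [|p g IH] /=; first by rewrite inflow0.
case/andP=> /(is_pathP _ _ yz)[q [-> uq _ _]] /IH IHg.
rewrite (inflowD w (fun=> erefl)) IHg inflow_path_arcs //.
by rewrite passes_set1 in_cons (negbTE wy).
Qed.

Lemma is_flow_path_flow N y z g : y != z -> arc_disjoint N y z g ->
  is_flow N y z (path_flow g) /\ flow_value y (path_flow g) = Posz (size g).
Proof.
move=> yz [gp gc]; split.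
  apply/is_flowP; split=> // u uy uz; rewrite (flow_value_path_flow _ yz gp).
  by rewrite ![_ == u]eq_sym (negbTE uy) (negbTE uz) mul0r.
by rewrite (flow_value_path_flow _ yz gp) eqxx [z == y]eq_sym (negbTE yz) mul1r.
Qed.

(** A flow [f] of positive value is larger than the zero flow in the network
    whose capacities are [f], where an augmenting path of the zero flow is a
    path of the support of [f]. Removing that path lowers the value by 1. *)
Lemma flow_decomposition N y z f n : y != z ->
  is_flow N y z f -> flow_value y f = Posz n ->
  exists g, [/\ all (is_path N y z) g, size g = n &
    forall a, path_flow g a <= f a].
Proof.
move=> yz; elim: n f => [|n IH] f ff fv; first by exists [::].
have /is_flowP[fc fb] := ff.
pose Nf := Network f (card_gt1 N).
have f0 : is_flow Nf y z (fun=> 0).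
  by split=> // u _ _; rewrite inflow0 outflow0.
have ffNf : is_flow Nf y z f by case: ff.
have lt0f : (flow_value y (fun _ : arc V => 0) < flow_value y f)%R.
  by rewrite fv /flow_value inflow0 outflow0.
have [q [pq uq lq]] := augmenting_path f0 ffNf lt0f.
have fpos a : a \in path_arcs (y :: q) -> 0 < f a.
  (* The zero flow has nothing to cancel: all residual edges are arcs of
     positive capacity [f]. *)
  move=> /(path_arcs_edge pq) /orP[] /existsP[b /and3P[/eqP sb /eqP tb]] //.
  suff -> : b = a by [].
  apply: val_inj; move: sb tb; rewrite /src /tgt.
  by case: (val a) (val b) => [? ?] [? ?] /= -> ->.
pose f' a := f a - (a \in path_arcs (y :: q)).
have fE a : f a = f' a + (a \in path_arcs (y :: q)).
  by rewrite subnK //; case: (boolP (a \in _)) => // /fpos.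
have f'v w : flow_value w f' =
    (flow_value w f - (Posz (y == w) - Posz (z == w)))%R.
  by rewrite (flow_valueD w fE) flow_value_path_arcs // lq addrK.
have ff' : is_flow N y z f'.
  apply/is_flowP; split=> [a|u uy uz]; first exact: leq_trans (leq_subr _ _) _.
  by rewrite f'v fb // ![_ == u]eq_sym (negbTE uy) (negbTE uz).
have [|g [gp gs gc]] := IH f' ff'.
  by rewrite f'v fv eqxx [z == y]eq_sym (negbTE yz) intS; lia.
exists ((y :: q) :: g); split=> /=; last 2 first.
- by rewrite gs.
- by move=> a; rewrite fE addnC leq_add2r.
rewrite gp andbT; apply/is_pathP=> //; exists q; split=> // a /fpos fa.
exact: leq_trans fa (fc a).
Qed.

(** * Comparison of the two quantities *)

Lemma avoiding_paths N X y z g :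
  arc_disjoint N y z g ->
  arc_disjoint (delete N X) y z [seq p <- g | ~~ passes X p].
Proof.
case=> gp gc.
have avoid p a : ~~ passes X p -> a \in path_arcs p ->
    cap (delete N X) a = cap N a.
  move=> /negPn/eqP pX /path_arcs_ends/andP[sa ta] /=.
  have notX v : v \in p -> v \notin X.
    move=> vp; apply/negP=> vX.
    by have := in_set0 v; rewrite -pX !inE vX vp.
  by rewrite (negbTE (notX _ sa)) (negbTE (notX _ ta)).
split.
  rewrite all_filter; apply: sub_all gp => p /and5P[sp up hp lp /forall_inP cp].
  apply/implyP=> pX; apply/and5P; split=> //; apply/forall_inP=> a ap.
  by rewrite (avoid p) //; apply: cp.
(* The capacity of an arc with an end in [X] has dropped to 0, but no path that
   avoids [X] uses such an arc. *)
move=> a; rewrite count_filter.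
have [/hasP[p pg /andP[ap pX]]|] := boolP (has
    (predI (fun p => a \in path_arcs p) (fun p => ~~ passes X p)) g).
  rewrite (avoid p) //; apply: leq_trans (gc a).
  by apply: sub_count => q /andP[].
by rewrite has_count -eqn0Ngt => /eqP->.
Qed.

Lemma is_flow_delete N X y z f :
  is_flow (delete N X) y z f ->
  is_flow N y z f /\ (forall x, x \in X -> inflow f x = 0 /\ outflow f x = 0).
Proof.
case=> fc fb; split; first split=> //.
  by move=> a; apply: leq_trans (fc a) _ => /=; case: ifP.
by move=> x xX; split; apply: big1 => a /eqP aE; apply/eqP; rewrite -leqn0;
  apply: leq_trans (fc a) _; rewrite /= aE xX ?orbT.
Qed.

Lemma max_flow_valueE N y z f :
  is_max_flow N y z f -> max_flow_value N y z = flow_value y f.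
Proof.
rewrite /max_flow_value; case: cid => h [fh maxh] [ff maxf] /=.
by apply/eqP; rewrite eq_le maxh // maxf.
Qed.

Lemma max_flow_ge0 N y z f : is_max_flow N y z f -> (0 <= flow_value y f)%R.
Proof.
case=> _ maxf; have /maxf : is_flow N y z (fun=> 0).
  by split=> // u _ _; rewrite inflow0 outflow0.
by rewrite {1}/flow_value inflow0 outflow0.
Qed.

Lemma max_arc_disjoint_size N y z g : y != z ->
  max_arc_disjoint N y z g -> Posz (size g) = max_flow_value N y z.
Proof.
move=> yz [gd gmax]; have [f maxf] := max_flow_exists N y z.
rewrite (max_flow_valueE maxf); apply/eqP; rewrite eq_le; apply/andP; split.
  have [fg <-] := is_flow_path_flow yz gd; exact: maxf.2.
have vf := gez0_abs (max_flow_ge0 maxf).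
have [h [hp hs hc]] := flow_decomposition yz maxf.1 (esym vf).
rewrite -vf lez_nat -hs; apply: gmax; split=> // a.
by apply: leq_trans (hc a) _; case: maxf.1.
Qed.

Lemma phi_le_lambda N X y z : y != z ->
  (phi N y z X <= Posz (lambda N y z X))%R.
Proof.
move=> yz; rewrite /lambda; case: cid => g [gmax _] /=.
have [ff fv] := is_flow_path_flow yz (avoiding_paths X gmax.1).
have [h maxh] := max_flow_exists (delete N X) y z.
have := maxh.2 _ ff; rewrite /phi (max_flow_valueE maxh) fv.
rewrite -(max_arc_disjoint_size yz gmax) size_filter.
have := count_predC (passes X) g; rewrite /num_passing.
have -> : count (predC (passes X)) g = count (fun p => ~~ passes X p) g by [].
lia.
Qed.

(** Obtained by augmenting a maximum flow of the network without [x], which is a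
    flow of [N] with inflow 0 at [x]. *)
Lemma max_flow_small_inflow N x y z : y != z ->
  exists f, is_max_flow N y z f /\ (Posz (inflow f x) <= phi N y z [set x])%R.
Proof.
move=> yz.
have [f maxf] := max_flow_exists N y z.
have [h maxh] := max_flow_exists (delete N [set x]) y z.
have [fh /(_ x (set11 x))[hx _]] := is_flow_delete maxh.1.
have le_hf := maxf.2 _ fh.
have [|f' [ff' f'v f'i]] :=
    @augment_to_max _ N y z h f `|flow_value y f - flow_value y h|%N yz fh maxf.1.
  lia.
exists f'; split; first by split=> // k /maxf.2; rewrite f'v.
rewrite /phi (max_flow_valueE maxf) (max_flow_valueE maxh).
have := f'i x; rewrite hx; lia.
Qed.

Lemma lambda_le_phi N x y z : y != z ->
  (Posz (lambda N y z [set x]) <= phi N y z [set x])%R.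
Proof.
move=> yz; rewrite /lambda; case: cid => g [gmax gmin] /=.
(* A flow of the network without its source has value 0, so phi is the length
   of [g], a trivial bound. *)
have [->|xy] := eqVneq x y.
  rewrite /phi -(max_arc_disjoint_size yz gmax).
  have [h maxh] := max_flow_exists (delete N [set y]) y z.
  have [_ /(_ y (set11 y))[hi ho]] := is_flow_delete maxh.1.
  rewrite (max_flow_valueE maxh) /flow_value hi ho.
  have := count_size (passes [set y]) g; rewrite /num_passing; lia.
have [f [maxf fx]] := max_flow_small_inflow N x yz; apply: le_trans fx.
have vf := gez0_abs (max_flow_ge0 maxf).
have [h [hp hs hc]] := flow_decomposition yz maxf.1 (esym vf).
have hd : arc_disjoint N y z h.
  by split=> // a; apply: leq_trans (hc a) _; case: maxf.1.
have hmax : max_arc_disjoint N y z h.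
  split=> // k kd; have [fk fkv] := is_flow_path_flow yz kd.
  by rewrite hs -lez_nat vf -fkv; apply: maxf.2.
rewrite lez_nat; apply: leq_trans (gmin _ hmax) _.
by rewrite -(inflow_path_flow yz hp xy); apply: leq_sum => a _; apply: hc.
Qed.

End Paths.

Theorem theorem19 (V : finType) (N : network V) (x y z : V) (hyz : y != z) :
  Posz (lambda N y z [set x]) = phi N y z [set x].
Proof.
by apply: le_anti; rewrite lambda_le_phi // phi_le_lambda.
Qed.
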